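(* Let $\mathscr{I}$ be a non-empty set. For each $i\in\mathscr{I}$ let $\lambda_i\geqslant 1$ be a cardinal, let $S_i$ be a countably compact Hausdorff semitopological monoid with zero, and let $B^0_{\lambda_i}(S_i)$ be a Hausdorff countably compact topological Brandt $\lambda_i^0$-extension of $S_i$. Suppose that the Tychonoff product $\prod\{S_i\colon i\in\mathscr{I}\}$ is a countably compact space. Then the direct product $\prod\{B^0_{\lambda_i}(S_i)\colon i\in\mathscr{I}\}$ with the Tychonoff topology is a Hausdorff countably compact semitopological semigroup.
   Context: All topological spaces are Hausdorff. A semitopological semigroup is a Hausdorff topological space with a separately continuous associative operation; a semitopological monoid is a semitopological semigroup with identity. Direct products of semigroups carry the coordinatewise operation. Brandt $\lambda^0$-extension: for a monoid $S$ with zero $0_S$ and a cardinal $\lambda\geqslant 1$, $B^0_\lambda(S)$ is the set $\{(\alpha,s,\beta)\colon \alpha,\beta\in\lambda,\ s\in S\setminus\{0_S\}\}\sqcup\{0\}$ with the operation in which $0$ is the zero and $(\alpha,a,\beta)\cdot(\gamma,b,\delta)$ equals $(\alpha,ab,\delta)$ if $\beta=\gamma$ and $ab\neq 0_S$, and equals $0$ otherwise. For $\alpha,\beta\in\lambda$ put $S_{\alpha,\beta}=\{(\alpha,s,\beta)\colon s\in S\setminus\{0_S\}\}\cup\{0\}$. Topological Brandt $\lambda^0$-extension: for a semitopological monoid $(S,\tau)$ with zero, it is $B^0_\lambda(S)$ with a Hausdorff topology $\tau_B$ such that $(B^0_\lambda(S),\tau_B)$ is a semitopological semigroup and, for some $\alpha\in\lambda$,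 the map $0_S\mapsto 0$, $s\mapsto(\alpha,s,\alpha)$ ($s\neq 0_S$) is a homeomorphism of $(S,\tau)$ onto the subspace $S_{\alpha,\alpha}$. A space is countably compact if each countable open cover has a finite subcover. *)

(* Defs.v *)
From HB Require Import structures.
From mathcomp Require Import all_boot all_classical topology function_spaces.

Set Implicit Arguments.
Unset Strict Implicit.
Unset Printing Implicit Defensive.

Local Open Scope classical_set_scope.
Local Open Scope group_scope.

(* Only the carrier, the operation and the topology: continuity and separation
   are expressed by [semitopological] below. *)
#[short(type="topSemigroupType")]
HB.structure Definition TopSemigroup := {T of Semigroup T & Topological T}.

HB.mixin Record Monoid_hasZero S of Monoid S := {
  zerog : S;
  mul0g : left_zero zerog (@mul S);
  mulg0 : right_zero zerog (@mul S)
}.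

#[short(type="monoid0Type")]
HB.structure Definition Monoid0 := {S of Monoid_hasZero S & Monoid S}.

#[short(type="topMonoid0Type")]
HB.structure Definition TopMonoid0 := {S of Monoid0 S & Topological S}.

Definition semitopological (T : topSemigroupType) : Prop :=
  [/\ hausdorff_space T,
      forall a : T, continuous (fun x : T => a * x)
    & forall a : T, continuous (fun x : T => x * a)].

(* [cover_compact] restricted to countable covers. *)
Definition countably_compact (T : topologicalType) (A : set T) : Prop :=
  forall (I : choiceType) (D : set I) (f : I -> set T), countable D ->
  (forall i, D i -> open (f i)) -> A `<=` cover D f ->
  finite_subset_cover D f A.

(* [{within A, continuous g}] is continuity for the subspace topology of [A]: the
   points outside [A] are isolated there, so the values of [g] outside [A] are
   irrelevant. *)
Definition homeomorphism_onto (X Y : topologicalType) (f : X -> Y)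
    (A : set Y) : Prop :=
  set_bij setT A f /\
  exists g : Y -> X,
    [/\ cancel f g, continuous f & {within A, continuous g}].

Record topology (T : Type) := Topology {
  opens : set (set T);
  opens_setT : opens setT;
  opens_setI : setI_closed opens;
  opens_bigcup : forall F : set (set T),
    F `<=` opens -> opens (\bigcup_(U in F) U)
}.

Definition with_topology (T : Type) (tau : topology T) : Type := T.

Section WithTopology.
Context (T : semigroupType) (tau : topology T).

HB.instance Definition _ := Semigroup.on (with_topology tau).

Fact opens_bigU (I : Type) (f : I -> set T) :
  (forall i, opens tau (f i)) -> opens tau (\bigcup_i f i).
Proof.
move=> fo; rewrite -[X in opens tau X](bigcup_image setT f id).
by apply: opens_bigcup => _ [i _ <-].
Qed.

HB.instance Definition _ := isOpenTopological.Build (with_topology tau)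
  (opens_setT tau) (@opens_setI _ tau) opens_bigU.

Fact open_with_topologyE : @open (with_topology tau) = opens tau.
Proof.
apply/seteqP; split=> [A|A oA].
  rewrite openE => oA.
  have -> : A = \bigcup_(U in [set U | opens tau U /\ U `<=` A]) U.
    apply/seteqP; split=> x; last by case=> U [_]; apply.
    by move=> /oA [U [oU Ux UA]]; exists U.
  by apply: opens_bigcup => U [].
by rewrite openE => x Ax; exists A; split.
Qed.

End WithTopology.

(* [None] is the zero; the cardinal is given by a set [L] of that size. *)
Definition brandt (L : choiceType) (S : monoid0Type) : Type :=
  option (L * {s : S | s != zerog} * L).

Section Brandt.
Context (L : choiceType) (S : monoid0Type).

HB.instance Definition _ := Choice.on (brandt L S).

(* [insub s] is [None] exactly when [s] is zero, so [brandt_elt a zerog b] is the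
   zero of [brandt L S]. *)
Definition brandt_elt (a : L) (s : S) (b : L) : brandt L S :=
  omap (fun t => (a, t, b)) (insub s).

Definition brandt_mul (x y : brandt L S) : brandt L S :=
  match x, y with
  | Some (a, s, b), Some (c, t, d) =>
      if b == c then brandt_elt a (val s * val t) d else None
  | _, _ => None
  end.

Fact brandt_mulA : associative brandt_mul.
Proof.
have E a s b c t d : brandt_mul (brandt_elt a s b) (Some (c, t, d)) =
    if b == c then brandt_elt a (s * val t) d else None.
  rewrite /brandt_elt; case: insubP => [u _ <- //|/=].
  by rewrite negbK => /eqP ->; rewrite mul0g insubF ?eqxx //=; case: ifP.
have E' a s b c t d : brandt_mul (Some (c, t, d)) (brandt_elt a s b) =
    if d == a then brandt_elt c (val t * s) b else None.
  rewrite /brandt_elt; case: insubP => [u _ <- //|/=].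
  by rewrite negbK => /eqP ->; rewrite mulg0 insubF ?eqxx //=; case: ifP.
have E0 x : brandt_mul x None = None by case: x => [[[a s] b]|].
have SS a s b c t d : brandt_mul (Some (a, s, b)) (Some (c, t, d)) =
    if b == c then brandt_elt a (val s * val t) d else None by [].
move=> [[[a s] b]|] // [[[c t] d]|] [[[e u] f]|]; rewrite ?E0 // !SS.
by case de: (d == e); case bc: (b == c); rewrite ?E ?E' ?E0 ?de ?bc ?mulgA.
Qed.

HB.instance Definition _ := isSemigroup.Build (brandt L S) brandt_mulA.

Definition brandt_block (a b : L) : set (brandt L S) :=
  [set x | x = None \/ exists s, x = Some (a, s, b)].

End Brandt.

Definition topological_brandt_extension (L : choiceType) (S : topMonoid0Type)
    (tau : topology (brandt L S)) : Prop :=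
  semitopological (with_topology tau) /\
  exists a : L, homeomorphism_onto
    (fun s : S => brandt_elt a s a : with_topology tau) (brandt_block a a).

Section DirectProduct.
Context (I : Type) (T : I -> topSemigroupType).

Definition prod_mul (x y : prod_topology T) : prod_topology T :=
  fun i => x i * y i.

Fact prod_mulA : associative prod_mul.
Proof. by move=> x y z; apply: functional_extensionality_dep => i; exact: mulgA. Qed.

HB.instance Definition _ := isSemigroup.Build (prod_topology T) prod_mulA.

End DirectProduct.

(* Main.v *)
Require Import Defs.
From mathcomp Require Import finmap.
From mathcomp Require Import all_boot all_classical topology function_spaces.

Local Open Scope classical_set_scope.

(** Each factor is a continuous image of [S_i] times a compact space.

    In a countably compact topological Brandt extension [B] of [S], every
    neighbourhood [U] of the zero contains all but finitely many of the sets
    [{(a, s, b) | s <> 0}] ([brandt_nbhs0_finite]): these sets are open and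
    pairwise disjoint, so points chosen outside [U] in infinitely many of them
    would have no cluster point. Hence, if [K] is the one-point
    compactification of the discrete space of index pairs, the map
    [S * K -> B] with [(s, (a, b)) |-> (a, s, b)] and [(s, oo) |-> 0] is
    continuous at the points [(s, oo)] ([brandt_glue_continuous]). At the other
    points it is continuous because every [s |-> (a, s, b)] is: the definition
    of an extension gives this for a single pair [(c, c)], and multiplying by
    [(a, 1, c)] on the left and [(c, 1, b)] on the right carries it to [(a, b)].

    Taking products, [\prod_i B_i] is a continuous image of
    [\prod_i S_i * \prod_i K_i]. The second factor is compact by Tychonoff's
    theorem and the first one is countably compact by hypothesis, and the
    product of a countably compact space and a compact space is countably
    compact ([countably_compact_prod_compact]). Arguing on the whole product at
    once is what makes the hypothesis on [\prod_i S_i] enough, since countable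
    compactness of the factors is not inherited by products. *)

(** * Countable compactness *)

Lemma countably_compact_image (X Y : topologicalType) (g : X -> Y) :
  continuous g -> range g = setT ->
  countably_compact [set: X] -> countably_compact [set: Y].
Proof.
move=> /continuousP gc gs Xcc J D f Dct fo cov.
have [|x _|D' sD' cov'] := Xcc J D (fun i => g @^-1` f i) Dct.
- by move=> i /fo; exact: gc.
- by have [i Di fi] := cov (g x) I; exists i.
exists D' => // y _; have [x _ <-] : range g y by rewrite gs.
by have [i iD' fi] := cov' x I; exists i.
Qed.

(** The members of the cover, listed as a sequence, have increasing partial
    unions [W n]. By compactness of [K], each fibre [{x} * K] lies in some
    [W n], and (tube lemma) the [x] for which it lies in a given [W n] form an
    open set [V n]; countable compactness of [X] is applied to the [V n]. *)
Lemma countably_compact_prod_compact (X K : topologicalType) :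
  countably_compact [set: X] -> compact [set: K] ->
  countably_compact [set: X * K].
Proof.
move=> Xcc /compact_near_coveringP Knc J D f /countable_injP[rk rk_inj] fo cov.
pose W n := \bigcup_(i in D `&` [set i | (rk i <= n)%N]) f i.
pose V n := [set x : X | [set: K] `<=` [set k | W n (x, k)]].
have Wo n : open (W n) by apply: bigcup_open => i [/fo].
have Vo n : open (V n).
  rewrite openE => x Vx; apply: (Knc _ _ (fun x' k => W n (x', k))) => k _.
  have := Wo n; rewrite openE => /(_ (x, k) (Vx k I))[[P Q] /= [xP kQ] PQ].
  by exists (Q, P) => // -[k' x'] [/= ? ?]; apply: PQ.
have covV : [set: X] `<=` cover setT V.
  move=> x _; suff : \forall n \near \oo, [set: K] `<=` [set k | W n (x, k)].
    by move=> /filter_ex[n Vn]; exists n.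
  apply: Knc => k _; have [i Di fi] := cov (x, k) I.
  have := fo i Di; rewrite openE => /(_ _ fi)[[P Q] /= [xP kQ] PQ].
  exists (Q, [set n | (rk i <= n)%N]) => [|[k' n] [/= Qk' le_in]].
    by split=> //; exact: nbhs_infty_ge.
  by exists i => //; apply: PQ; split=> //=; exact: nbhs_singleton.
have [D' _ covD'] := Xcc _ _ V (countableP _) (fun n _ => Vo n) covV.
pose N := \max_(n <- D') n.
have fin : finite_set (D `&` [set i | (rk i <= N)%N]).
  rewrite -(eq_finite_set (inj_card_eq (f := rk) _)).
    apply: sub_finite_set (finite_II N.+1) => _ [i [_ le_iN] <-].
    by rewrite /= ltnS.
  by move=> i j /set_mem[Di _] /set_mem[Dj _]; apply: rk_inj; exact: mem_set.
have /finite_fsetP[E defE] := fin.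
exists E => [i iE|[x k] _].
  by apply/mem_set; have : [set` E] i by []; rewrite -defE => -[].
have [n nD' Vn] := covD' x I.
have [i [Di le_in] fi] := Vn k I.
exists i => //; rewrite -defE; split=> //=.
by apply: leq_trans le_in _; exact: leq_bigmax_seq.
Qed.

(** * Products of arbitrary families *)

Section ProdTopology.
Context {I : Type} {T : I -> topologicalType}.

(* [{classic I}] is [I] with the decidable equality that excluded middle
   provides. *)
Lemma prod_topology_proj_continuous i :
  continuous (fun x : prod_topology T => x i).
Proof. exact: (@proj_continuous {classic I} T i). Qed.

Lemma prod_topology_continuous (X : topologicalType)
    (f : X -> prod_topology T) :
  (forall i, continuous (fun x => f x i)) -> continuous f.
Proof.
move=> fc x; apply/cvg_sup => i A [B [[C oC <-] Cfx] CA].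
apply: filterS CA _; apply: (fc i x C).
exact: open_nbhs_nbhs.
Qed.

Lemma prod_topology_hausdorff :
  (forall i, hausdorff_space (T i)) -> hausdorff_space (prod_topology T).
Proof. exact: (@hausdorff_product {classic I} T). Qed.

Lemma prod_topology_compact :
  (forall i, compact [set: T i]) -> compact [set: prod_topology T].
Proof.
move=> Tc; have := @tychonoff {classic I} T (fun=> setT) Tc.
by congr compact; apply/seteqP; split.
Qed.

End ProdTopology.

Lemma semitopological_prod (I : Type) (T : I -> topSemigroupType) :
  (forall i, semitopological (T i)) -> semitopological (prod_topology T).
Proof.
move=> Tsemi; split=> [|a|a].
- by apply: prod_topology_hausdorff => i; case: (Tsemi i).
- apply: prod_topology_continuous => i x.
  have [_ ml _] := Tsemi i.
  exact: (continuous_comp (prod_topology_proj_continuous i x) (ml _ _)).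
- apply: prod_topology_continuous => i x.
  have [_ _ mr] := Tsemi i.
  exact: (continuous_comp (prod_topology_proj_continuous i x) (mr _ _)).
Qed.

(** * The algebra of Brandt extensions *)

Section BrandtAlgebra.
Context {L : choiceType} {S : monoid0Type}.

Lemma brandt_elt_val (a : L) (s : {s : S | s != zerog}) (b : L) :
  brandt_elt a (val s) b = Some (a, s, b).
Proof. by rewrite /brandt_elt valK. Qed.

Lemma brandt_elt0 (a b : L) : brandt_elt a (zerog : S) b = None.
Proof. by rewrite /brandt_elt insubF //= eqxx. Qed.

Lemma brandt_elt_mul (a b c : L) (s t : S) :
  (brandt_elt a s b * brandt_elt b t c = brandt_elt a (s * t) c)%g.
Proof.
have [->|s0] := eqVneq s zerog; first by rewrite mul0g !brandt_elt0.
have [->|t0] := eqVneq t zerog.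
  by rewrite mulg0 !brandt_elt0; case: brandt_elt => // -[[]].
have -> : s = val (exist (fun s => s != zerog) s s0) by [].
have -> : t = val (exist (fun s => s != zerog) t t0) by [].
by rewrite !brandt_elt_val {1}/mul /= eqxx.
Qed.

Lemma brandt_elt_mul_neq (a b c d : L) (s t : S) : b != c ->
  (brandt_elt a s b * brandt_elt c t d)%g = None.
Proof.
by rewrite /brandt_elt => /negPf bc; case: insub; case: insub => //= u v;
  rewrite /mul /= bc.
Qed.

Definition brandt_cell (a b : L) : set (brandt L S) :=
  [set x | exists s, x = Some (a, s, b)].

(** Multiplying by [(a, 1, a)] on the left and by [(b, 1, b)] on the right
    fixes the cell of [(a, b)] and sends everything else to the zero. This
    description by translations is what makes cells open. *)
Lemma brandt_cellE a b :
  brandt_cell a b =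
  [set x | (brandt_elt a 1 a * x * brandt_elt b 1 b)%g != None].
Proof.
apply/seteqP; split=> [_ [s ->]|] /=.
  by rewrite -brandt_elt_val !brandt_elt_mul mul1g mulg1 brandt_elt_val.
case=> [[[c s] d]|]; last by rewrite /=; case: brandt_elt => [[[]]|].
rewrite /= -brandt_elt_val.
have [<-|ac] := eqVneq a c; last by rewrite brandt_elt_mul_neq.
rewrite brandt_elt_mul mul1g.
have [<-|db] := eqVneq d b; last by rewrite brandt_elt_mul_neq.
by rewrite brandt_elt_val; exists s.
Qed.

Lemma brandt_elt_cases (a b : L) (s : S) :
  brandt_elt a s b = None \/ brandt_cell a b (brandt_elt a s b).
Proof.
by rewrite /brandt_elt; case: insub => [u|]; [right; exists u|left].
Qed.

End BrandtAlgebra.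

(** * Topological Brandt extensions *)

Section BrandtExtension.
Context {L : choiceType} {S : topMonoid0Type} {tau : topology (brandt L S)}.
Local Notation B := (with_topology tau).
Local Notation elt a s b := (brandt_elt a s b : B).

Hypothesis Bext : topological_brandt_extension tau.

Lemma brandt_cell_open a b : open (brandt_cell a b : set B).
Proof.
have [[hB ml mr] _] := Bext.
rewrite brandt_cellE.
have -> : [set x : B | (brandt_elt a 1 a * x * brandt_elt b 1 b)%g != None] =
  (fun x : B => elt a 1%g a * x * elt b 1%g b)%g @^-1` ~` [set None].
  by apply/seteqP; split=> x /eqP.
apply: open_comp => [x _|].
  exact: continuous_comp (ml _ _) (mr _ _).
apply/closed_openC/accessible_closed_set1; exact: hausdorff_accessible.
Qed.

Lemma brandt_elt_continuous a b : continuous (fun s : S => elt a s b).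
Proof.
have [[_ ml mr] [c [_ [_ [_ cc _]]]]] := Bext.
have -> : (fun s : S => elt a s b) =
    (fun s : S => elt a 1%g c * elt c s c * elt c 1%g b)%g.
  by apply/funext => s; rewrite !brandt_elt_mul mul1g mulg1.
move=> s.
exact: (continuous_comp (continuous_comp (cc s) (ml _ _)) (mr _ _)).
Qed.

Hypothesis Bcc : countably_compact [set: B].

(** Otherwise there is a sequence of distinct cells [p n] with points [x n]
    outside [U]. The open set [W n], the union of [U] and of all the cells other
    than [p n], [p n.+1] and so on, contains [x m] only if [m < n], so the
    increasing sequence [W] covers the space but no single [W n] does. *)
Lemma brandt_nbhs0_finite (U : set B) : open U -> U None ->
  finite_set [set p : L * L | ~ brandt_cell p.1 p.2 `<=` U].
Proof.
move=> oU U0; apply: contrapT => /infiniteP/card_leP[f].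
pose p n := val (f (exist _ n (mem_set I))).
have p_inj : injective p.
  by move=> m n /val_inj/(inj (mem_set I) (mem_set I)) [].
have /choice[x xp] : forall n, exists x, brandt_cell (p n).1 (p n).2 x /\ ~ U x.
  move=> n; have := valP (f (exist _ n (mem_set I))).
  by move=> /set_mem/existsNP[x /not_implyP[? ?]]; exists x.
pose W n : set B := U `|` \bigcup_(q in [set q : L * L |
  forall m, (n <= m)%N -> q <> p m]) brandt_cell q.1 q.2.
have Wo n : open (W n).
  by apply: openU => //; apply: bigcup_open => q _; exact: brandt_cell_open.
have [|D' _ cov] := Bcc _ _ W (countableP setT) (fun n _ => Wo n).
  move=> [[[a s] b] _|_]; last by exists 0%N => //; left.
  have [[m pm]|np] := pselect (exists m, p m = (a, b)).
    exists m.+1 => //; right; exists (a, b); last by exists s.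
    by move=> k lt_mk; rewrite -pm => /p_inj mk; rewrite mk ltnn in lt_mk.
  exists 0%N => //; right; exists (a, b); last by exists s.
  by move=> m _ pm; apply: np; exists m.
pose N := \max_(n <- D') n.
have [xN NU] := xp N.
have [n nD' [//|[q qp xq]]] := cov (x N) I.
apply: (qp N); first exact: leq_bigmax_seq.
move: xq xN => [s ->] [t [E1 _ E2]].
by rewrite [LHS]surjective_pairing [RHS]surjective_pairing E1 E2.
Qed.

(** On underlying sets, this is the quotient map collapsing to one point, the
    zero, both the pairs with first component zero and those over the point at
    infinity. *)
Definition brandt_glue (y : S * one_point_compactification
    (discrete_topology (L * L)%type)) : B :=
  if y.2 is Some p then brandt_elt p.1 y.1 p.2 else None.

Lemma brandt_glue_continuous : continuous brandt_glue.
Proof.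
move=> [s [p|]] U; rewrite nbhsE => -[V [oV Vy] VU] /=; apply: filterS VU _.
  exists ((fun s => elt p.1 s p.2) @^-1` V, Some @` [set p]).
    split; first by apply: brandt_elt_continuous; exact: open_nbhs_nbhs.
    exact: (one_point_compactification_some_nbhs _ _ (discrete_set1 p)).
  by case=> s' _ [/= Vs' [_ -> <-]].
(* A finite set is closed and compact in the discrete space, so removing the
   finitely many pairs whose cell is not inside [V] leaves a neighbourhood of
   the point at infinity. *)
pose A : set (discrete_topology (L * L)%type) :=
  [set p : L * L | ~ brandt_cell p.1 p.2 `<=` V].
exists (setT, (Some @` ~` A) `|` [set None]).
  split; first exact: filterT.
  exists A => //; split; last exact: discrete_closed.
  by apply: finite_compact; exact: brandt_nbhs0_finite.
case=> s' _ [/= _ [[q /contrapT qV <-]|->]] //=.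
rewrite /brandt_glue /=.
by case: (brandt_elt_cases q.1 q.2 s') => [->//|]; exact: qV.
Qed.

Lemma brandt_glue_surj x : exists y, brandt_glue y = x.
Proof.
case: x => [[[a s] b]|].
  by exists (val s, Some (a, b)); exact: brandt_elt_val.
by exists (zerog, None).
Qed.

End BrandtExtension.

(** * The product theorem *)

Theorem theorem2p4 (I : Type) (I_neq0 : inhabited I)
  (L : I -> choiceType) (L_neq0 : forall i : I, inhabited (L i))
  (S : I -> topMonoid0Type)
  (S_semitop : forall i : I, semitopological (S i))
  (S_cc : forall i : I, countably_compact [set: S i])
  (tau : forall i : I, topology (brandt (L i) (S i)))
  (B_ext : forall i : I, topological_brandt_extension (tau i))
  (B_cc : forall i : I, countably_compact [set: with_topology (tau i)])
  (prodS_cc : countably_compact [set: prod_topology S]) :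
  semitopological (prod_topology (fun i : I => with_topology (tau i))) /\
  countably_compact [set: prod_topology (fun i : I => with_topology (tau i))].
Proof.
split; first by apply: semitopological_prod => i; case: (B_ext i).
pose K i := one_point_compactification (discrete_topology (L i * L i)%type).
pose g (y : prod_topology S * prod_topology K) :
  prod_topology (fun i => with_topology (tau i)) :=
  fun i => brandt_glue (y.1 i, y.2 i).
apply: (@countably_compact_image _ _ g).
- apply: prod_topology_continuous => i y.
  have c1 :
      (fun y : prod_topology S * prod_topology K => y.1 i) @ y --> y.1 i.
    apply: (@cvg_comp _ _ _ fst (fun x : prod_topology S => x i)).
      exact: cvg_fst.
    exact: (@prod_topology_proj_continuous I S i y.1).
  have c2 :
      (fun y : prod_topology S * prod_topology K => y.2 i) @ y --> y.2 i.
    apply: (@cvg_comp _ _ _ snd (fun x : prod_topology K => x i)).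
      exact: cvg_snd.
    exact: (@prod_topology_proj_continuous I K i y.2).
  have gc := @brandt_glue_continuous _ _ _ (B_ext i) (B_cc i) (y.1 i, y.2 i).
  exact: cvg_comp (cvg_pair c1 c2) gc.
- apply/seteqP; split=> // x _.
  pose h i := cid (@brandt_glue_surj _ _ (tau i) (x i)).
  exists (fun i => (sval (h i)).1, fun i => (sval (h i)).2) => //.
  apply: functional_extensionality_dep => i; rewrite /g /= -surjective_pairing.
  exact: (svalP (h i)).
- apply: countably_compact_prod_compact => //.
  apply: prod_topology_compact => i.
  exact: one_point_compactification_compact.
Qed.
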